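(* Let $G$ be a group and let $A$ be a set. Equip $A^G$ with the prodiscrete uniform structure and the shift action of $G$. Let $X \subset A^G$ be a $G$-invariant subset. Then the following conditions are equivalent: (a) $X$ is strongly irreducible; (b) the $G$-shift action on $X$ has the weak specification property.
   Context: $A^G$ is the set of all maps $x \colon G \to A$. The shift action is $(gx)(h) = x(g^{-1}h)$. The prodiscrete uniform structure on $A^G$ has as a base of entourages the sets $W(\Omega) = \{(x,y) : x|_\Omega = y|_\Omega\}$, $\Omega \subset G$ finite. $X$ carries the induced uniform structure. $X$ is $G$-invariant if $gX = X$ for all $g \in G$. For a finite subset $\Delta \subset G$, $X \subset A^G$ is $\Delta$-irreducible if for all finite subsets $\Omega_1,\Omega_2 \subset G$ with $\Omega_1 \cap \Omega_2\Delta = \varnothing$ and all $x_1,x_2 \in X$ there is $x \in X$ with $x|_{\Omega_k} = x_k|_{\Omega_k}$ for $k \in \{1,2\}$. $X$ is strongly irreducible if it is $\Delta$-irreducible for some finite $\Delta \subset G$. Weak specification property (for a uniformly continuous action of $G$ on a uniform space $X$): for every entourage $U$ of $X$ there is a finite subset $\Lambda \subset G$ such that for every finite sequence $\Omega_1,\dots,\Omega_n$ ($n\ge 1$) of finite subsets of $G$ with $\Omega_j \cap \Lambda\Omega_k = \varnothing$ for all distinct $j,k$, and every sequence $x_1,\dots,x_n$ of points of $X$, there is $x \in X$ with $(gx,gx_i) \in U$ for all $g \in \Omega_i$ and $1 \le i \le n$. *)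

(* Defs.v *)
From HB Require Import structures.
From mathcomp Require Import all_boot finmap.
From mathcomp Require Import all_classical topology.

Set Implicit Arguments.
Unset Strict Implicit.
Unset Printing Implicit Defensive.

Local Open Scope classical_set_scope.
Local Open Scope group_scope.

(* The product, over G, of the discrete uniform structure on A.  A is an
   arbitrary type: {classic A} is A with the choice structure provided by the
   classical axioms. *)
Definition prodiscrete (G A : Type) : Type :=
  {ptws G -> discrete_topology {classic A}}.

HB.instance Definition _ (G A : Type) := Uniform.copy (prodiscrete G A)
  {ptws G -> discrete_topology {classic A}}.

(* The basic entourage W(Omega). *)
Definition agree_ent (G A : Type) (Omega : set G) :
    set (prodiscrete G A * prodiscrete G A) :=
  [set xy : prodiscrete G A * prodiscrete G A | {in Omega, xy.1 =1 xy.2}].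

Lemma sup_ent1 (T : choiceType) (I : Type) (Tc : I -> Uniform T) i
    (V : set (T * T)) :
  @entourage (Uniform.Pack (Tc i)) V -> @sup_ent T I Tc V.
Proof.
move=> entV; exists V => //.
pose S := {p : {classic I} * set (T * T) |
  `[< @entourage (Uniform.Pack (Tc p.1)) p.2 >]}.
pose p : S := exist _ (i : {classic I}, V) (asboolT entV).
exact: (@finI_from1 _ _ setT (fun q : S => (projT1 q).2) p).
Qed.

Lemma prodiscrete_entourageP (G : choiceType) (A : Type)
    (E : set (prodiscrete G A * prodiscrete G A)) :
  entourage E <->
  exists2 Omega : set G, finite_set Omega & agree_ent (A := A) Omega `<=` E.
Proof.
split.
  case=> _ [F _ <-] FE.
  exists [set (projT1 p).1 | p in [set` F]].
    by apply: finite_image; exact: finite_fset.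
  move=> [x y] xy; apply: FE => -[[i V] /= entV] iF.
  have /asboolP [W entW WV] := entV.
  apply: WV => /=; apply: entW.
  exists (x i) => //; congr pair.
  by apply: xy; apply/mem_set; exists (exist _ (i, V) entV).
case=> Omega /finite_fsetP [S ->] SE.
apply: filterS SE _.
have -> : agree_ent (A := A) [set` S] = \bigcap_(h in [set` S])
    [set xy : prodiscrete G A * prodiscrete G A | xy.1 h = xy.2 h].
  apply/seteqP; split=> [xy xyS h Sh|xy xyS h /set_mem Sh]; last exact: xyS.
  by apply: xyS; exact/mem_set.
apply: filter_bigI => h _.
set V := [set xy | _].
apply: (@sup_ent1 _ _ _ h V).
exists [set uv | uv.1 = uv.2] => [|//].
by rewrite uniform_discrete => _ [u _ <-].
Qed.

Record unif_action (G : groupType) (T : uniformType) := UnifAction {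
  act :> G -> T -> T;
  act1 : forall x, act 1 x = x;
  actM : forall g h x, act (g * h) x = act g (act h x);
  act_unif : forall g, unif_continuous (act g) }.

Definition setmulg (G : groupType) (B C : set G) : set G :=
  [set b * c | b in B & c in C].

Definition weak_specification (G : groupType) (T : uniformType)
    (a : unif_action G T) : Prop :=
  forall U : set (T * T), entourage U ->
  exists2 Lambda : set G, finite_set Lambda &
    forall (n : nat) (Omega : 'I_n -> set G) (x_ : 'I_n -> T),
      (0 < n)%N ->
      (forall i, finite_set (Omega i)) ->
      (forall j k, j != k -> Omega j `&` setmulg Lambda (Omega k) = set0) ->
      exists x : T, forall i g, Omega i g -> U (a g x, a g (x_ i)).

Section Shift.
Variables (G : groupType) (A : Type).
Implicit Types (x y : prodiscrete G A) (X : set (prodiscrete G A)).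

Definition shift (g : G) x : prodiscrete G A := fun h => x (g^-1 * h).

Lemma shift1 x : shift 1 x = x.
Proof. by apply/funext => h; rewrite /shift invg1 mul1g. Qed.

Lemma shiftM g h x : shift (g * h) x = shift g (shift h x).
Proof. by apply/funext => k; rewrite /shift invgM mulgA. Qed.

Lemma shift_unif g : unif_continuous (shift g).
Proof.
move=> E /prodiscrete_entourageP [Omega finO OE].
apply/prodiscrete_entourageP; exists [set g^-1 * h | h in Omega].
  exact: finite_image.
move=> [x y] xy; apply: OE => h Oh /=; apply: xy.
by apply/mem_set; exists h => //; exact/set_mem.
Qed.

Definition shift_action : unif_action G (prodiscrete G A) :=
  UnifAction shift1 shiftM shift_unif.

Definition strongly_irreducible_for (Delta : set G) X : Prop :=
  forall Omega1 Omega2 : set G, finite_set Omega1 -> finite_set Omega2 ->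
  Omega1 `&` setmulg Omega2 Delta = set0 ->
  forall x1 x2, X x1 -> X x2 ->
  exists2 x, X x & {in Omega1, x =1 x1} /\ {in Omega2, x =1 x2}.

Definition strongly_irreducible X : Prop :=
  exists2 Delta : set G, finite_set Delta & strongly_irreducible_for Delta X.

End Shift.

Definition invariant_set (G : groupType) (T : uniformType)
    (a : unif_action G T) (X : set T) : Prop :=
  forall g, a g @` X = X.

(* The restriction of an action to an invariant subset X; the type associated
   with X carries the uniform structure induced by that of T. *)
Section Restriction.
Variables (G : groupType) (T : uniformType) (a : unif_action G T).
Variables (X : set T) (invX : invariant_set a X).

Lemma restr_subproof g (x : X) : a g (val x) \in X.
Proof.
apply/mem_set; have : (a g @` X) (a g (val x)).
  by exists (val x) => //; exact: set_valP.
by rewrite invX.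
Qed.

Definition restr g (x : X) : X := exist _ (a g (val x)) (restr_subproof g x).

Lemma restr1 x : restr 1 x = x.
Proof. by apply: val_inj; rewrite /= act1. Qed.

Lemma restrM g h x : restr (g * h) x = restr g (restr h x).
Proof. by apply: val_inj; rewrite /= actM. Qed.

Lemma restr_unif g : unif_continuous (restr g).
Proof.
move=> E [W entW WE]; exists ((fun xy => (a g xy.1, a g xy.2)) @^-1` W).
  exact: act_unif entW.
by move=> [x y] Wxy; apply: WE.
Qed.

Definition restr_action : unif_action G X :=
  UnifAction restr1 restrM restr_unif.

End Restriction.

(* Main.v *)
(* The point [g x] restricted to [Omega] is [x] restricted to [g^-1 Omega], so
   tracing the orbits of the [x_i] along [Omega_i] up to [W(Omega)] means
   agreeing with [x_i] on [Omega_i^-1 Omega].  These sets are [Delta]-separated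
   as soon as the [Omega_i] are [Omega Delta^-1 Omega^-1]-separated, and
   irreducibility, applied to one set against the union of the others, extends
   by induction from two patterns to finitely many.  Conversely, the
   specification property for [W({1})] and two sets [Omega_1^-1], [Omega_2^-1]
   is irreducibility with respect to [Lambda `|` Lambda^-1]. *)
Require Import Defs.
From mathcomp Require Import all_boot all_classical topology.

Set Implicit Arguments.
Unset Strict Implicit.
Unset Printing Implicit Defensive.

Local Open Scope classical_set_scope.
Local Open Scope group_scope.

Lemma finite_setmulg (G : groupType) (B C : set G) :
  finite_set B -> finite_set C -> finite_set (setmulg B C).
Proof. exact: finite_image2. Qed.

(** The head index fills the first slot of irreducibility and the union over the tail the second:
    [setmulg] distributes over that union, so pairwise separation suffices. [X !=set0] settles the
    empty list. *)
Lemma strongly_irreducible_seq (G : groupType) (A : Type)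
    (X : set (prodiscrete G A)) (Delta : set G) (I : eqType)
    (E : I -> set G) (x_ : I -> prodiscrete G A) (s : seq I) :
  strongly_irreducible_for Delta X -> X !=set0 ->
  (forall i, finite_set (E i)) -> (forall i, X (x_ i)) ->
  (forall j k, j != k -> E j `&` setmulg (E k) Delta = set0) ->
  uniq s ->
  exists2 x, X x & forall i, i \in s -> {in E i, x =1 x_ i}.
Proof.
move=> irrX X0 finE Xx_ sepE; elim: s => [_|i s IHs /= /andP[i_s uniq_s]].
  by case: X0 => x Xx; exists x.
have [y Xy y_s] := IHs uniq_s.
have finEs : finite_set (\bigcup_(k in [set` s]) E k).
  by apply: bigcup_finite => // k _; exact: finE.
have sep_is : E i `&` setmulg (\bigcup_(k in [set` s]) E k) Delta = set0.
  rewrite -subset0 => h [Eih [b [k /= ks Ekb] [d Dd bd]]].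
  change (set0 h); rewrite -(sepE i k); last by apply: contraNneq i_s => ->.
  by split; [exact: Eih | exists b => //; exists d].
have [x Xx [x_i x_s]] := irrX _ _ (finE i) finEs sep_is _ _ (Xx_ i) Xy.
exists x => // j; rewrite in_cons => /predU1P[->//|js] h /set_mem Ejh.
rewrite x_s; last by apply/mem_set; exists j.
by apply: y_s => //; exact/mem_set.
Qed.

Lemma strongly_irreducible_weak_specification (G : groupType) (A : Type)
    (X : set (prodiscrete G A)) (invX : invariant_set (shift_action G A) X) :
  strongly_irreducible X -> weak_specification (restr_action invX).
Proof.
move=> [Delta finD irrX] U [W /prodiscrete_entourageP [Omega finO OW] WU].
exists (setmulg Omega (setmulg [set g^-1 | g in Delta] [set g^-1 | g in Omega])).
  by do ?[apply: finite_setmulg => //]; exact: finite_image.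
move=> n F x_ n_gt0 finF sepF.
pose E i := setmulg [set g^-1 | g in F i] Omega.
have finE i : finite_set (E i) by apply: finite_setmulg => //; exact: finite_image.
(* A common point [g^-1 * h = g'^-1 * h' * d] gives [g = h * d^-1 * h'^-1 * g'], which [sepF]
   forbids; the finite set supplied above is read off from this equation. *)
have sepE j k : j != k -> E j `&` setmulg (E k) Delta = set0.
  move=> jk; rewrite -subset0 => _ [[_ [g Fg <-]] [h Oh <-]].
  move=> [_ [_ [g' Fg' <-] [h' Oh' <-]] [d Dd eq_gg']].
  change (set0 g); rewrite -(sepF j k jk); split; first exact: Fg.
  exists (h * (d^-1 * h'^-1)).
    exists h => //; exists (d^-1 * h'^-1) => //.
    by exists d^-1; [exists d | exists h'^-1; [exists h'|]].
  exists g' => //.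
  have -> : h * (d^-1 * h'^-1) * g' = h * (g'^-1 * h' * d)^-1.
    by rewrite !invgM invgK !mulgA.
  by rewrite eq_gg' invgM invgK mulgA mulgV mul1g.
have Xx_ i : X (val (x_ i)) by exact: set_valP.
(* [X] may be empty a priori; [0 < n] provides a point. *)
have X0 : X !=set0 by exists (val (x_ (Ordinal n_gt0))).
have [x Xx x_E] :=
  strongly_irreducible_seq irrX X0 finE Xx_ sepE (enum_uniq 'I_n).
exists (exist _ x (mem_set Xx)) => i g Fg.
apply: WU; apply: OW => h /set_mem Oh /=.
apply: (x_E i); first by rewrite mem_enum.
by apply/mem_set; exists g^-1; [exists g | exists h].
Qed.

Lemma weak_specification_strongly_irreducible (G : groupType) (A : Type)
    (X : set (prodiscrete G A)) (invX : invariant_set (shift_action G A) X) :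
  weak_specification (restr_action invX) -> strongly_irreducible X.
Proof.
move=> specX.
pose W := agree_ent (A := A) [set (1 : G)].
pose U := [set xy : X * X | W (val xy.1, val xy.2)].
have [|Lambda finL specL] := specX U.
  by exists W => //; apply/prodiscrete_entourageP; exists [set (1 : G)].
(* Specification asks for separation in both orders, irreducibility for one only. With inverted
   sets, [w1^-1 = l * w2^-1] means [w1 = w2 * l^-1], while [w2^-1 = l * w1^-1] means [w1 = w2 * l]:
   each half of the union excludes one order. *)
exists (Lambda `|` [set g^-1 | g in Lambda]).
  by rewrite finite_setU; split => //; exact: finite_image.
move=> Omega1 Omega2 fin1 fin2 sep12 x1 x2 Xx1 Xx2.
(* The inverses appear because [shift h^-1 x] takes at [1] the value [x h]. *)
pose F (i : 'I_2) := [set g^-1 | g in if i == ord0 then Omega1 else Omega2].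
pose x_ (i : 'I_2) : X := if i == ord0 then exist _ x1 (mem_set Xx1)
                          else exist _ x2 (mem_set Xx2).
have finF i : finite_set (F i).
  by apply: finite_image; case: ifP.
have sepF j k : j != k -> F j `&` setmulg Lambda (F k) = set0.
  rewrite /F -subset0; case: (eqVneq j ord0) (eqVneq k ord0) => [->|j0] [k0|k0] //.
  - move=> _ _ [[w1 O1 <-] [l Ll [_ [w2 O2 <-] eq12]]].
    change (set0 w1); rewrite -sep12; split; first exact: O1.
    exists w2 => //; exists l^-1; first by right; exists l.
    by apply: invg_inj; rewrite invgM invgK.
  - move=> _ _ [[w2 O2 <-] [l Ll [_ [w1 O1 <-] eq21]]].
    change (set0 w1); rewrite -sep12; split; first exact: O1.
    exists w2 => //; exists l; first by left.
    by rewrite -[w2]invgK -eq21 invgM invgK mulgVK.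
  - have ord2 (i : 'I_2) : i != ord0 -> i = ord_max.
      by case: i => [[|[|m]] lt_m] //= _; exact: val_inj.
    by rewrite (ord2 _ j0) (ord2 _ k0) eqxx.
have [x x_F] := specL 2 F x_ isT finF sepF.
have agree i h : F i h^-1 -> val x h = val (x_ i) h.
  move=> Fh; have /(_ 1 (mem_set erefl)) := x_F i _ Fh.
  by rewrite /= /shift invgK mulg1.
exists (val x); first exact: set_valP.
split=> h /set_mem Oh.
  by apply: (agree ord0); exists h.
by apply: (agree ord_max); exists h.
Qed.

Theorem proposition6p7 (G : groupType) (A : Type) (X : set (prodiscrete G A))
    (invX : invariant_set (shift_action G A) X) :
  strongly_irreducible X <-> weak_specification (restr_action invX).
Proof.
split; first exact: strongly_irreducible_weak_specification.
exact: weak_specification_strongly_irreducible.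
Qed.
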